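(* Let $r\in\{2,3\}$ and let $\alpha\ge 1$ be an integer. Then $g(r,2,\alpha)=r\alpha$. In particular, there exist a graph $G$ with $\alpha(G)=\alpha$ and a coloring of its edges with $r$ colors such that $V(G)$ cannot be covered by the vertex sets of $r\alpha-1$ monochromatic subgraphs of $G$, each of diameter at most $2$.
   Context: Graphs are finite and simple; $\alpha(G)$ is the independence number. A monochromatic subgraph is a subgraph (not necessarily induced) all of whose edges have the same color; a single vertex counts as a monochromatic subgraph. Different subgraphs in a cover may have different colors, and need not be disjoint or distinct. The diameter of a graph $H$ is the smallest integer $d$ with $d_H(u,v)\le d$ for all $u,v\in V(H)$, where distances are measured in $H$ itself ($\infty$ if there is no path); a one-vertex graph has diameter $0$. $g(r,d,\alpha)$ denotes the minimum $k$ such that for every graph $G$ with $\alpha(G)=\alpha$ and every coloring of the edges of $G$ with $r$ colors, $V(G)$ can be covered by the vertex sets of $k$ monochromatic subgraphs of diameter at most $d$. *)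

(* Defs.v *)
From mathcomp Require Import all_boot.

Set Implicit Arguments.
Unset Strict Implicit.
Unset Printing Implicit Defensive.

Definition is_minimum (P : nat -> Prop) (m : nat) : Prop :=
  P m /\ forall n, P n -> m <= n.

Record sgraph := SGraph {
  vertex :> finType;
  edge : rel vertex;
  edge_sym : symmetric edge;
  edge_irrefl : irreflexive edge
}.

Definition independent (G : sgraph) (S : {set G}) : bool :=
  [forall x in S, forall y in S, ~~ edge x y].

Definition indep_number (G : sgraph) : nat :=
  \max_(S : {set G} | independent S) #|S|.

(* The colour of the edge xy is [c [set x; y]]; the values of [c] on sets that
   are not edges are never used. *)
Definition edge_coloring (G : sgraph) (r : nat) := {set G} -> 'I_r.

(* A subgraph, not necessarily induced. *)
Record subgraph (G : sgraph) := Subgraph {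
  sub_vertices : {set G};
  sub_edge : rel G;
  sub_edge_sym : symmetric sub_edge;
  sub_edgeP : forall x y, sub_edge x y ->
    [/\ edge x y, x \in sub_vertices & y \in sub_vertices]
}.

Definition monochromatic (G : sgraph) (r : nat) (c : edge_coloring G r)
    (H : subgraph G) : Prop :=
  exists i : 'I_r, forall x y, sub_edge H x y -> c [set x; y] = i.

Definition has_walk (G : sgraph) (H : subgraph G) (u v : G) (n : nat) : Prop :=
  exists p : seq G, [/\ path (sub_edge H) u p, last u p = v & size p = n].

(* Distances and diameters may be infinite, so they are given as relations;
   "at most d" entails finiteness. *)
Definition is_dist (G : sgraph) (H : subgraph G) (u v : G) (n : nat) : Prop :=
  is_minimum (has_walk H u v) n.

Definition dist_at_most (G : sgraph) (H : subgraph G) (u v : G) (d : nat) :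
    Prop :=
  exists2 n, is_dist H u v n & n <= d.

Definition is_diameter (G : sgraph) (H : subgraph G) (n : nat) : Prop :=
  is_minimum (fun d => forall u v, u \in sub_vertices H ->
                v \in sub_vertices H -> dist_at_most H u v d) n.

Definition diameter_at_most (G : sgraph) (H : subgraph G) (d : nat) : Prop :=
  exists2 n, is_diameter H n & n <= d.

(* The family [H] need not be injective: subgraphs may be repeated. *)
Definition coverable (G : sgraph) (r : nat) (c : edge_coloring G r)
    (d k : nat) : Prop :=
  exists H : 'I_k -> subgraph G,
    (forall i, monochromatic c (H i) /\ diameter_at_most (H i) d) /\
    \bigcup_(i < k) sub_vertices (H i) = [set: G].

(* [is_g r d alpha m] states that g(r, d, alpha) is defined and equals m. *)
Definition is_g (r d alpha m : nat) : Prop :=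
  is_minimum (fun k => forall (G : sgraph) (c : edge_coloring G r),
                indep_number G = alpha -> coverable c d k) m.

(* Main.v *)
Require Import Defs.
From mathcomp Require Import all_boot.
From Stdlib Require Import Classical.

Set Implicit Arguments.
Unset Strict Implicit.
Unset Printing Implicit Defensive.

(** For the upper bound, the monochromatic stars centred at the vertices of a
    maximum independent set cover the graph.  For the lower bound, split [K_4]
    into two paths on four vertices, and [K_7] into the three Hamiltonian
    cycles of [Z/7] with differences 1, 2 and 3.  A monochromatic subgraph of
    diameter at most 2 then has at most 3 vertices, so [r - 1] of them miss a
    vertex of [K_(3r - 2)].  In a disjoint union of [alpha] copies, a subgraph
    of finite diameter meets at most one copy, and each copy needs [r]. *)

(** Distances and diameters are minima of arbitrary [Prop]-valued predicates, so passing from an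
    upper bound to a minimum uses classical well-ordering. *)
Lemma exists_minimum (P : nat -> Prop) n :
  P n -> exists2 m, is_minimum P m & m <= n.
Proof.
elim/ltn_ind: n => n IHn Pn.
have [[k ltkn Pk]|noP] := classic (exists2 k, k < n & P k).
  have [m minm lemk] := IHn k ltkn Pk.
  by exists m => //; exact: leq_trans lemk (ltnW ltkn).
exists n => //; split=> // k Pk; rewrite leqNgt; apply/negP => ltkn.
by apply: noP; exists k.
Qed.

Lemma dist_at_mostP (G : sgraph) (H : subgraph G) u v d :
  dist_at_most H u v d <->
  exists p, [/\ path (sub_edge H) u p, last u p = v & size p <= d].
Proof.
split=> [[n [[p [Hp Hl Hs]] _] led]|[p [Hp Hl led]]].
  by exists p; rewrite Hs.
have [//|m minm lem] := @exists_minimum (has_walk H u v) (size p).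
  by exists p.
by exists m => //; exact: leq_trans led.
Qed.

Lemma diameter_at_mostP (G : sgraph) (H : subgraph G) d :
  diameter_at_most H d <->
  (forall u v, u \in sub_vertices H -> v \in sub_vertices H ->
     dist_at_most H u v d).
Proof.
split=> [[n [Hn _] led] u v Hu Hv|Hd].
  by have [m Hm lem] := Hn u v Hu Hv; exists m => //; exact: leq_trans led.
pose P d := forall u v, u \in sub_vertices H -> v \in sub_vertices H ->
  dist_at_most H u v d.
by have [m minm lem] := @exists_minimum P d Hd; exists m.
Qed.

Lemma coverable_finType (T : finType) (G : sgraph) r (c : edge_coloring G r)
    d (F : T -> subgraph G) :
  (forall t, monochromatic c (F t) /\ diameter_at_most (F t) d) ->
  (forall x, exists t, x \in sub_vertices (F t)) -> coverable c d #|T|.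
Proof.
move=> HF cov; exists (fun k => F (enum_val k)); split=> [k|].
  exact: HF.
apply/setP=> x; rewrite inE; apply/bigcupP; have [t xt] := cov x.
by exists (enum_rank t); rewrite ?enum_rankK.
Qed.

(** An outside vertex with no neighbour in a maximum independent set could be added to it. *)
Lemma indep_number_dominating (G : sgraph) :
  exists2 S : {set G}, #|S| = indep_number G &
    forall x, x \notin S -> exists2 s, s \in S & edge s x.
Proof.
have ind0 : independent (set0 : {set G}).
  by apply/forall_inP=> x; rewrite inE.
have [|S indS maxS] := @eq_bigmax_cond _ (@independent G) (fun S => #|S|).
  by apply/card_gt0P; exists set0.
exists S => // x xS.
case: (boolP [exists s in S, edge s x]) => [/exists_inP[s sS sx]|].
  by exists s.
rewrite negb_exists_in => /forall_inP nadj.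
suff indxS : independent (x |: S).
  have := @leq_bigmax_cond _ (@independent G) (fun S => #|S|) _ indxS.
  by rewrite maxS cardsU1 xS add1n ltnn.
apply/forall_inP=> u; rewrite in_setU1 => uxS.
apply/forall_inP=> v; rewrite in_setU1 => vxS.
case/predU1P: uxS => [->|uS]; case/predU1P: vxS => [->|vS].
- by rewrite edge_irrefl.
- by rewrite edge_sym nadj.
- exact: nadj.
- by move/forall_inP: indS => /(_ u uS)/forall_inP/(_ v vS).
Qed.

Section Star.
Variables (G : sgraph) (r : nat) (c : edge_coloring G r) (i : 'I_r) (s : G).

Definition star_leaf x := edge s x && (c [set s; x] == i).

Definition star_edge : rel G :=
  fun x y => (x == s) && star_leaf y || (y == s) && star_leaf x.

Lemma star_edge_sym : symmetric star_edge.
Proof. by move=> x y; rewrite /star_edge orbC. Qed.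

Lemma star_edgeP x y : star_edge x y ->
  [/\ edge x y, x \in s |: [set z | star_leaf z]
    & y \in s |: [set z | star_leaf z]].
Proof.
rewrite !inE => /orP[] /andP[/eqP-> leaf]; rewrite leaf eqxx ?orbT //=.
  by have /andP[] := leaf.
by have /andP[] := leaf; rewrite edge_sym.
Qed.

Definition star := Subgraph star_edge_sym star_edgeP.

Lemma star_monochromatic : monochromatic c star.
Proof.
exists i => x y /orP[] /andP[/eqP-> /andP[_ /eqP]] //.
by rewrite setUC.
Qed.

Lemma star_diameter : diameter_at_most star 2.
Proof.
apply/diameter_at_mostP=> u v; rewrite !inE => us vs.
apply/dist_at_mostP.
case/predU1P: us => [->|us]; case/predU1P: vs => [->|vs].
- by exists [::].
- by exists [:: v]; rewrite /= /star_edge eqxx vs.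
- by exists [:: s]; rewrite /= /star_edge eqxx us orbT.
- by exists [:: s; v]; rewrite /= /star_edge eqxx us vs orbT.
Qed.

End Star.

Lemma coverable_stars (G : sgraph) r (c : edge_coloring G r) :
  coverable c 2 (r * indep_number G).
Proof.
have [S <- domS] := indep_number_dominating G.
have -> : r * #|S| = #|{: 'I_r * {x | x \in S}}|.
  by rewrite card_prod card_ord card_sig.
apply: (@coverable_finType _ _ _ _ _ (fun t => star c t.1 (val t.2))).
  by move=> t; split; [exact: star_monochromatic | exact: star_diameter].
move=> x; case: (boolP (x \in S)) => [xS|/domS[s sS sx]].
  (* A centre lies in its own star whatever the colour; [c set0] only supplies some element of
     ['I_r]. *)
  by exists (c set0, exist _ x xS); rewrite /= !inE eqxx.
exists (c [set s; x], exist _ s sS).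
by rewrite /= !inE /star_leaf sx eqxx orbT.
Qed.

(** Colourings act on vertex sets, so a pair is picked back from [[set x; y]]; the symmetry of [f]
    makes the order picked irrelevant. *)
Lemma edge_coloring_of_rel (G : sgraph) r (f : G -> G -> 'I_r) (i0 : 'I_r) :
  (forall x y, f x y = f y x) ->
  exists c : edge_coloring G r, forall x y, c [set x; y] = f x y.
Proof.
move=> fC.
exists (fun S => if [pick p : G * G | S == [set p.1; p.2]] is Some p
                 then f p.1 p.2 else i0) => x y.
case: pickP => [[u v] /= /eqP eqS|/(_ (x, y))]; last by rewrite eqxx.
have : x \in [set u; v] by rewrite -eqS set21.
have : y \in [set u; v] by rewrite -eqS set22.
have : u \in [set x; y] by rewrite eqS set21.
have : v \in [set x; y] by rewrite eqS set22.
rewrite !inE => /orP[]/eqP-> /orP[]/eqP-> //.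
- by rewrite orbb => /eqP->.
- by move=> _; rewrite orbb => /eqP->.
Qed.

Section DisjointCliques.
Variables (alpha : nat) (T : finType).

Definition cliques_edge : rel ('I_alpha * T) :=
  fun x y => (x.1 == y.1) && (x.2 != y.2).

Lemma cliques_edge_sym : symmetric cliques_edge.
Proof. by move=> x y; rewrite /cliques_edge eq_sym (eq_sym x.2). Qed.

Lemma cliques_edge_irrefl : irreflexive cliques_edge.
Proof. by move=> x; rewrite /cliques_edge !eqxx. Qed.

Definition cliques := SGraph cliques_edge_sym cliques_edge_irrefl.

Lemma indep_number_cliques (t0 : T) : indep_number cliques = alpha.
Proof.
apply/eqP; rewrite eqn_leq; apply/andP; split.
  apply/bigmax_leqP=> S /forall_inP indS.
  (* An independent set has at most one vertex in each clique, so the first projection is injective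
     on it. *)
  rewrite -[X in _ <= X]card_ord; apply: (@leq_card_in _ _ (fun x => x.1)).
  move=> [j t] [j' t'] xS yS /= eqj; subst j'.
  have /forall_inP/(_ _ yS) := indS _ xS.
  by rewrite /= /cliques_edge /= eqxx /= negbK => /eqP->.
pose S : {set cliques} := [set (j, t0) | j in 'I_alpha].
have -> : alpha = #|S| by rewrite card_imset ?card_ord // => j j' [].
apply: leq_bigmax_cond; apply/forall_inP=> _ /imsetP[j _ ->].
by apply/forall_inP=> _ /imsetP[j' _ ->]; rewrite /= /cliques_edge eqxx andbF.
Qed.

Lemma cliques_path_fst (H : subgraph cliques) x p :
  path (sub_edge H) x p -> (last x p).1 = x.1.
Proof.
elim: p x => //= y p IHp x /andP[/sub_edgeP[/andP[/eqP-> _] _ _]].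
exact: IHp.
Qed.

End DisjointCliques.

Section LowerBound.
Variables (T : finType) (r : nat) (f : T -> T -> 'I_r).

(** A walk of at most two edges of colour [i] in the complete graph on [T]; the equalities admit the
    shorter walks. *)
Definition color_near i u v :=
  [exists w, ((u == w) || (f u w == i)) && ((w == v) || (f w v == i))].

(** Count the pairs of a subgraph and a clique that it meets. A subgraph gives at most one pair,
    being connected; a clique gives at least [r], since [r.-1] traces of at most [m] vertices cannot
    cover it. *)
Lemma cliques_cover_lower_bound alpha m (t0 : T) :
  (forall x y, f x y = f y x) ->
  (forall i (S : {set T}), {in S &, forall u v, color_near i u v} ->
     #|S| <= m) ->
  m * r.-1 < #|T| ->
  exists (G : sgraph) (c : edge_coloring G r),
    indep_number G = alpha /\ forall k, coverable c 2 k -> r * alpha <= k.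
Proof.
move=> fC fm ltm; exists (cliques alpha T).
have [|c cE] := @edge_coloring_of_rel (cliques alpha T) r
  (fun x y => f x.2 y.2) (f t0 t0); first by move=> x y; exact: fC.
exists c; split=> [|k [H [HH covH]]]; first exact: indep_number_cliques.
pose W i j := [set t | (j, t) \in sub_vertices (H i)].
have Wm i j : #|W i j| <= m.
  have [[a Ha] /diameter_at_mostP diamH] := HH i.
  apply: (fm a) => u v; rewrite !inE => uW vW.
  have /dist_at_mostP[p [Hp lastp]] := diamH _ _ uW vW.
  have Ef x y : sub_edge (H i) x y -> f x.2 y.2 = a by move/Ha; rewrite cE.
  case: p Hp lastp => [_ [->] _|x [|y [|//]]] /=.
  - by apply/existsP; exists v; rewrite eqxx.
  - move=> /andP[/Ef/= eqa _] lx _; apply/existsP; exists v.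
    by rewrite -eqa lx !eqxx orbT.
  - move=> /and3P[/Ef/= eqa /Ef/= eqb _] ly _; apply/existsP; exists x.2.
    by rewrite eqa -eqb ly !eqxx !orbT.
have Wj i : \sum_(j < alpha | W i j != set0) 1 <= 1.
  rewrite sum1dep_card; apply/card_le1_eqP=> j j'; rewrite !inE.
  move=> /set0Pn[t]; rewrite inE => tW /set0Pn[t']; rewrite inE => tW'.
  have [_ /diameter_at_mostP diamH] := HH i.
  have /dist_at_mostP[p [Hp lastp _]] := diamH _ _ tW tW'.
  by have := cliques_path_fst Hp; rewrite lastp.
have Nj j : r <= \sum_(i < k | W i j != set0) 1.
  have cover_j : #|T| <= \sum_(i < k | W i j != set0) #|W i j|.
    rewrite -sum1_card.
    under [X in _ <= X]eq_bigr do rewrite -sum1_card.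
    rewrite (exchange_big_dep predT) //=; apply: leq_sum => t _.
    have : (j, t) \in \bigcup_(i < k) sub_vertices (H i) by rewrite covH inE.
    case/bigcupP=> i _ tH; have tW : t \in W i j by rewrite inE.
    by rewrite (bigD1 i) //= tW andbT; apply/set0Pn; exists t.
  have le_mN : #|T| <= m * \sum_(i < k | W i j != set0) 1.
    rewrite big_distrr /=; apply: leq_trans cover_j _.
    by apply: leq_sum => i _; rewrite muln1.
  (* Cancelling [m] shows that the count exceeds [r.-1], hence is at least [r], trivially so when
     [r] is 0. *)
  by have := leq_trans ltm le_mN; rewrite ltn_mul2l => /andP[_]; case: (r).
rewrite mulnC -[alpha]card_ord -sum_nat_const -[k]card_ord -sum1_card.
apply: (@leq_trans (\sum_(j < alpha) \sum_(i < k | W i j != set0) 1)).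
  by apply: leq_sum => j _; exact: Nj.
by rewrite (exchange_big_dep predT) //; apply: leq_sum => i _; exact: Wj.
Qed.

End LowerBound.

(** A boolean counterpart of [color_near] on plain numbers, which evaluates by computation. *)
Definition dist_near (s : seq nat) n a u v :=
  has (fun w => ((u == w) || (nth 0 s ((u - w) + (w - u)) == a))
             && ((w == v) || (nth 0 s ((w - v) + (v - w)) == a))) (iota 0 n).

(** The finite check behind the bound of 3 vertices for a monochromatic subgraph of diameter at most
    2. *)
Definition dist_near_free (s : seq nat) n r :=
  all (fun a => all (fun x => all (fun y => all (fun z => all (fun t =>
    uniq [:: x; y; z; t] ==> ~~ pairwise (dist_near s n a) [:: x; y; z; t])
  (iota 0 n)) (iota 0 n)) (iota 0 n)) (iota 0 n)) (iota 0 r).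

(* [K_n] is coloured by giving the edge [uv] the colour [nth 0 s `|u - v|];
   the sums of truncated differences are [`|u - v|]. *)
Lemma dist_coloring_lower_bound (s : seq nat) n r alpha :
  all (gtn r.+1) s -> dist_near_free s n.+1 r.+1 -> 3 * r < n.+1 ->
  exists (G : sgraph) (c : edge_coloring G r.+1),
    indep_number G = alpha /\ forall k, coverable c 2 k -> r.+1 * alpha <= k.
Proof.
move=> /allP s_lt free lt3r.
pose f (u v : 'I_n.+1) : 'I_r.+1 := inord (nth 0 s ((u - v) + (v - u))).
apply: (@cliques_cover_lower_bound _ _ f alpha 3 ord0); last 1 first.
- by rewrite card_ord.
- by move=> x y; rewrite /f addnC.
move=> a S nearS; rewrite leqNgt; apply/negP => S4.
(* [inord] alters no colour: the entries of [s] are below [r.+1], and so is the default 0. *)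
have fE u v : (f u v == a) = (nth 0 s ((u - v) + (v - u)) == a).
  rewrite -(inj_eq val_inj) /= inordK //.
  have [ltd|led] := ltnP ((u - v) + (v - u)) (size s).
    exact: s_lt (mem_nth 0 ltd).
  by rewrite nth_default.
have nearE u v : u \in S -> v \in S -> dist_near s n.+1 a u v.
  move=> uS vS; have /existsP[w Hw] := nearS u v uS vS.
  apply/hasP; exists (val w); first by rewrite mem_iota ltn_ord.
  by move: Hw; rewrite !fE.
have ordI (x : 'I_n.+1) : val x \in iota 0 n.+1 by rewrite mem_iota /= ltn_ord.
(* The first four entries of the enumeration of [S] contradict [free]. *)
move: S4 (enum_uniq S) (mem_enum S); rewrite cardE.
case: (enum S) => [|x [|y [|z [|t l]]]] // _ uniqS memS.
have [xS yS zS tS] : [/\ x \in S, y \in S, z \in S & t \in S].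
  by rewrite -!memS !inE !eqxx !orbT.
have aI : val a \in iota 0 r.+1 by rewrite mem_iota /= ltn_ord.
have /implyP := allP (allP (allP (allP (allP free _ aI) _ (ordI x)) _ (ordI y))
  _ (ordI z)) _ (ordI t).
have -> : uniq [:: val x; val y; val z; val t].
  rewrite (map_inj_uniq val_inj [:: x; y; z; t]).
  exact: subseq_uniq (prefix_subseq [:: x; y; z; t] l) uniqS.
by move=> /(_ isT); rewrite /= !nearE.
Qed.

Theorem mainTheorem5 (r alpha : nat) (hr : r = 2 \/ r = 3)
    (halpha : 1 <= alpha) :
  is_g r 2 alpha (r * alpha) /\
  exists (G : sgraph) (c : edge_coloring G r),
    indep_number G = alpha /\ ~ coverable c 2 (r * alpha - 1).
Proof.
have [G [c [Galpha lbG]]] : exists (G : sgraph) (c : edge_coloring G r),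
    indep_number G = alpha /\ forall k, coverable c 2 k -> r * alpha <= k.
  case: hr => ->.
    (* Difference 1 gives the path 0-1-2-3, differences 2 and 3 the path 2-0-3-1. The entry at index
       0 is a filler; the check is done by evaluation. *)
    by apply: (@dist_coloring_lower_bound [:: 0; 0; 1; 1] 3).
  (* Differences [d] and [7 - d] agree modulo 7 up to sign, hence the palindrome after the filler at
     index 0. *)
  by apply: (@dist_coloring_lower_bound [:: 0; 0; 1; 2; 2; 1; 0] 6).
split.
  split=> [G' c' <-|k Hk]; first exact: coverable_stars.
  exact/lbG/Hk.
exists G, c; split=> // /lbG.
(* Positivity ensures that the truncated [r * alpha - 1] is really smaller than [r * alpha]. *)
have : 0 < r * alpha by rewrite muln_gt0 halpha andbT; case: hr => ->.
by case: (r * alpha) => // N _; rewrite subn1 ltnn.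
Qed.
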